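(* Let $d\ge 1$ be a fixed integer, let $\mathbf{P}_0,\dots,\mathbf{P}_6\in\mathbb{R}^d$ be control points and $\omega_0,\dots,\omega_6>0$ be weights, and let $$\mathbf{R}(t)=\frac{\sum_{i=0}^{6}\omega_i B_i^6(t)\,\mathbf{P}_i}{\sum_{i=0}^{6}\omega_i B_i^6(t)},\qquad 0\le t\le 1,$$ be the corresponding rational Bézier curve of degree $6$. Put $\Delta_i=\mathbf{P}_{i+1}-\mathbf{P}_i$ for $0\le i\le 5$ and $$\Omega=\max_{0\le i\le 5}\max\left\{\frac{\omega_{i+1}}{\omega_i},\frac{\omega_i}{\omega_{i+1}}\right\}.$$ Then for every $t\in[0,1]$, $$\|\mathbf{R}'(t)\|\le 6\,\Omega\max_{0\le i\le 5}\|\Delta_i\|.$$ Moreover, the right-hand side can be evaluated from the weights and control points in $\mathcal{O}(1)$ time, which is optimal for a fixed degree.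
   Context: $B_i^n(t)=\binom{n}{i}t^i(1-t)^{n-i}$ denotes the Bernstein basis functions, and $\|\cdot\|$ is the Euclidean norm on $\mathbb{R}^d$. Time is counted in elementary real operations (arithmetic operations, comparisons, and evaluation of the norm of a vector in $\mathbb{R}^d$ with $d$ fixed, each at unit cost). *)

(* Defs.v *)
From HB Require Import structures.
From mathcomp Require Import all_boot all_order all_algebra.
From mathcomp Require Import all_classical all_reals all_analysis.

Set Implicit Arguments.
Unset Strict Implicit.
Unset Printing Implicit Defensive.

Import Order.TTheory GRing.Theory Num.Theory.
Import numFieldNormedType.Exports.

Local Open Scope ring_scope.

(* The library's norm on ['rV[R]_d] is the sup norm. *)
Definition enorm (R : realType) (d : nat) (v : 'rV[R]_d) : R :=
  Num.sqrt (\sum_(j < d) v 0 j ^+ 2).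

Definition bernstein (R : realType) (n i : nat) (t : R) : R :=
  'C(n, i)%:R * t ^+ i * (1 - t) ^+ (n - i).

(* The formula is taken on all of R.  For positive weights the denominator is
   positive on [0, 1], hence on a neighbourhood of [0, 1], so at the end points
   the two-sided derivative is the one-sided derivative of the curve. *)
Definition rational_bezier (R : realType) (d n : nat)
    (P : 'I_n.+1 -> 'rV[R]_d) (w : 'I_n.+1 -> R) (t : R) : 'rV[R]_d :=
  (\sum_(i < n.+1) w i * bernstein n i t)^-1 *:
    \sum_(i < n.+1) (w i * bernstein n i t) *: P i.

(* For [i : 'I_n], [lo i] and [hi i] are the indices i and i + 1 in 'I_n.+1. *)
Definition lo (n : nat) (i : 'I_n) : 'I_n.+1 := widen_ord (leqnSn n) i.
Definition hi (n : nat) (i : 'I_n) : 'I_n.+1 := lift ord0 i.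

Definition Delta (R : realType) (d n : nat) (P : 'I_n.+1 -> 'rV[R]_d)
    (i : 'I_n) : 'rV[R]_d := P (hi i) - P (lo i).

(* The maxima below are over nonnegative quantities, so the default value 0
   does not affect them when 0 < n. *)
Definition Omega (R : realType) (n : nat) (w : 'I_n.+1 -> R) : R :=
  \big[Num.max/0]_(i < n) Num.max (w (hi i) / w (lo i)) (w (lo i) / w (hi i)).

Definition derivative_bound (R : realType) (d n : nat)
    (P : 'I_n.+1 -> 'rV[R]_d) (w : 'I_n.+1 -> R) : R :=
  n%:R * Omega w * \big[Num.max/0]_(i < n) enorm (Delta P i).

(* Programs over the reals, with registers for the weights, for the
   coordinates of the control points, and countably many scratch registers. *)
Definition reg (n d : nat) : eqType :=
  ('I_n.+1 + 'I_n.+1 * 'I_d + nat)%type.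

Definition wreg (n d : nat) (i : 'I_n.+1) : reg n d := inl (inl i).
Definition preg (n d : nat) (i : 'I_n.+1) (j : 'I_d) : reg n d :=
  inl (inr (i, j)).
Definition scratch (n d k : nat) : reg n d := inr k.

Definition state (R : realType) (n d : nat) := reg n d -> R.

Definition input_state (R : realType) (n d : nat)
    (P : 'I_n.+1 -> 'rV[R]_d) (w : 'I_n.+1 -> R) : state R n d :=
  fun x => match x with
           | inl (inl i) => w i
           | inl (inr (i, j)) => P i 0 j
           | inr _ => 0
           end.

Definition update (R : realType) (n d : nat) (s : state R n d)
    (x : reg n d) (a : R) : state R n d :=
  fun y => if y == x then a else s y.

Inductive arith_op : Type := OpAdd | OpSub | OpMul | OpDiv.

Definition arith_eval (R : realType) (o : arith_op) (a b : R) : R :=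
  match o with
  | OpAdd => a + b
  | OpSub => a - b
  | OpMul => a * b
  | OpDiv => a / b
  end.

Definition arith_defined (R : realType) (o : arith_op) (b : R) : Prop :=
  if o is OpDiv then b != 0 else True.

Inductive cmd (R : realType) (n d : nat) : Type :=
| Skip
| Const (x : reg n d) (a : R)
| Copy (x y : reg n d)
| Arith (o : arith_op) (x y z : reg n d)
| Norm (x : reg n d) (v : 'I_d -> reg n d)
| Seq (c1 c2 : cmd R n d)
| IfLe (y z : reg n d) (c1 c2 : cmd R n d)
| WhileLe (y z : reg n d) (c : cmd R n d).

Arguments Skip {R n d}.

(* [exec c s k s'] : started in [s], [c] terminates in [s'] after [k]
   elementary operations.  Arithmetic operations, evaluations of the Euclidean
   norm and comparisons cost 1; loading a constant, copying a register and
   sequencing are free; between two counted operations a fixed program performs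
   a bounded number of these.  Division by 0 is stuck. *)
Inductive exec (R : realType) (n d : nat) :
    cmd R n d -> state R n d -> nat -> state R n d -> Prop :=
| ExecSkip s : exec Skip s 0 s
| ExecConst x a s : exec (Const x a) s 0 (update s x a)
| ExecCopy x y s : exec (Copy R x y) s 0 (update s x (s y))
| ExecArith o x y z s : arith_defined o (s z) ->
    exec (Arith R o x y z) s 1 (update s x (arith_eval o (s y) (s z)))
| ExecNorm x v s :
    exec (Norm R x v) s 1 (update s x (enorm (\row_(j < d) s (v j))))
| ExecSeq c1 c2 s s1 s2 k1 k2 :
    exec c1 s k1 s1 -> exec c2 s1 k2 s2 -> exec (Seq c1 c2) s (k1 + k2) s2
| ExecIfTrue y z c1 c2 s s1 k : s y <= s z ->
    exec c1 s k s1 -> exec (IfLe y z c1 c2) s k.+1 s1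
| ExecIfFalse y z c1 c2 s s1 k : s z < s y ->
    exec c2 s k s1 -> exec (IfLe y z c1 c2) s k.+1 s1
| ExecWhileTrue y z c s s1 s2 k1 k2 : s y <= s z ->
    exec c s k1 s1 -> exec (WhileLe y z c) s1 k2 s2 ->
    exec (WhileLe y z c) s (k1 + k2).+1 s2
| ExecWhileFalse y z c s : s z < s y -> exec (WhileLe y z c) s 1 s.

(* On the given weights and control points, [c] stops after [k] elementary
   operations with the value [r] in scratch register 0. *)
Definition evaluates_to (R : realType) (n d : nat) (c : cmd R n d)
    (P : 'I_n.+1 -> 'rV[R]_d) (w : 'I_n.+1 -> R) (k : nat) (r : R) : Prop :=
  exists2 s : state R n d, exec c (input_state P w) k s & s (scratch n d 0) = r.

Definition computes_bound (R : realType) (n d : nat) (c : cmd R n d) : Prop :=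
  forall (P : 'I_n.+1 -> 'rV[R]_d) (w : 'I_n.+1 -> R),
    (forall i, 0 < w i) -> exists k, evaluates_to c P w k (derivative_bound P w).

Definition runs_within (R : realType) (n d : nat) (c : cmd R n d) (T : nat) :
    Prop :=
  forall (P : 'I_n.+1 -> 'rV[R]_d) (w : 'I_n.+1 -> R),
    (forall i, 0 < w i) ->
    exists k r, (k <= T)%N /\ evaluates_to c P w k r.

Definition takes_at_least (R : realType) (n d : nat) (c : cmd R n d)
    (T : nat) : Prop :=
  forall (P : 'I_n.+1 -> 'rV[R]_d) (w : 'I_n.+1 -> R),
    (forall i, 0 < w i) ->
    forall k r, evaluates_to c P w k r -> (T <= k)%N.

(* Main.v *)
(** With a_i = w_i B_i(t), S = sum a_i and t(1-t) B_i' = (i - n t) B_i one gets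
    2 t(1-t) S^2 R'(t) = sum_(i,j) (i - j) a_i a_j (P_i - P_j), hence
    |R'(t)| <= max |Delta_i| * Var / (t(1-t)), where Var is the variance of the
    index i under the probabilities a_i / S.  It remains to find a centre m with
    sum a_i (6 Omega t(1-t) - (i - m)^2) >= 0.  We take
      m = 6 (t^2 + Omega t(1-t)) / (t^2 + 2 Omega t(1-t) + (1-t)^2),
    which is 6t for Omega = 1, and agrees to first order with the mean of the
    extreme weights Omega^i at t = 0 and Omega^(6-i) at t = 1.  The sum is
    linear in the weights, and the signs of its coefficients are -, +, -; so on
    the cone of weights whose consecutive ratios lie in [1/Omega, Omega] it is
    nonnegative as soon as it is for the seven valleys w_i = Omega^|i-k|.
    For these it is a polynomial inequality in t and Omega: on the regions
    t/(1-t) >= Omega and 1 <= t/(1-t) <= Omega, and on their mirror images, a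
    substitution makes all coefficients nonnegative (after subtracting two
    squares), which is decided by computation. *)

Require Import Defs.
From Stdlib Require Import ZArith.
From mathcomp Require Import all_boot all_order all_algebra.
From mathcomp Require Import all_classical all_reals all_analysis.
From mathcomp Require Import ring lra zify ssrZ.
Import Order.TTheory GRing.Theory Num.Theory.
Import numFieldNormedType.Exports.
Local Open Scope ring_scope.

(** * The Euclidean norm on row vectors *)

Section EuclideanNorm.
Context {R : realType} {d : nat}.
Implicit Types u v : 'rV[R]_d.

Lemma enorm_ge0 u : 0 <= enorm u.
Proof. exact: sqrtr_ge0. Qed.

Lemma sqr_enorm u : enorm u ^+ 2 = \sum_(j < d) u 0 j ^+ 2.
Proof. by rewrite sqr_sqrtr// sumr_ge0// => j _; exact: sqr_ge0. Qed.

Lemma enorm_eq0 u : enorm u = 0 -> u = 0.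
Proof.
move=> u0; apply/rowP => j; rewrite mxE; apply/eqP; rewrite -sqrf_eq0; apply/eqP.
have := sqr_enorm u; rewrite u0 expr0n /= => /esym.
by move/psumr_eq0P; apply => // k _; exact: sqr_ge0.
Qed.

Lemma enorm0 : enorm (0 : 'rV[R]_d) = 0.
Proof.
by rewrite /enorm big1 ?sqrtr0// => j _; rewrite mxE expr0n.
Qed.

Lemma enormZ a u : enorm (a *: u) = `|a| * enorm u.
Proof.
rewrite -sqrtr_sqr /enorm -sqrtrM ?sqr_ge0//; congr Num.sqrt.
by rewrite mulr_sumr; apply: eq_bigr => j _; rewrite mxE exprMn.
Qed.

Lemma enormN u : enorm (- u) = enorm u.
Proof. by rewrite -scaleN1r enormZ normrN1 mul1r. Qed.

(** Multiplied by [2 |u| |v|], the difference of the two sides is the sum of the squares of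
    [|v| u_j - |u| v_j]. Zero norms are split off because this factor has to be positive. *)
Lemma cauchy_schwarz u v : \sum_(j < d) u 0 j * v 0 j <= enorm u * enorm v.
Proof.
have [u0|uN0] := eqVneq (enorm u) 0.
  rewrite u0 mul0r (enorm_eq0 u u0) big1// => j _; by rewrite mxE mul0r.
have [v0|vN0] := eqVneq (enorm v) 0.
  rewrite v0 mulr0 (enorm_eq0 v v0) big1// => j _; by rewrite mxE mulr0.
have uv0 : 0 < 2 * (enorm u * enorm v).
  by rewrite !mulr_gt0// lt0r ?uN0 ?vN0 enorm_ge0.
rewrite -(ler_pM2l uv0) -subr_ge0.
suff -> : 2 * (enorm u * enorm v) * (enorm u * enorm v) -
    2 * (enorm u * enorm v) * (\sum_(j < d) u 0 j * v 0 j) =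
    \sum_(j < d) (enorm v * u 0 j - enorm u * v 0 j) ^+ 2.
  by apply: sumr_ge0 => j _; exact: sqr_ge0.
under [RHS]eq_bigr => j _.
  rewrite (_ : _ ^+ 2 = enorm v ^+ 2 * u 0 j ^+ 2 + enorm u ^+ 2 * v 0 j ^+ 2
    - 2 * (enorm u * enorm v) * (u 0 j * v 0 j)); last ring.
  over.
rewrite sumrB big_split/= -!mulr_sumr -!sqr_enorm; ring.
Qed.

Lemma ler_enormD u v : enorm (u + v) <= enorm u + enorm v.
Proof.
rewrite -(ler_pXn2r (n := 2))// ?nnegrE ?addr_ge0 ?enorm_ge0//.
have -> : (enorm u + enorm v) ^+ 2 =
  enorm u ^+ 2 + enorm v ^+ 2 + 2 * (enorm u * enorm v) by ring.
have -> : enorm (u + v) ^+ 2 =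
    enorm u ^+ 2 + enorm v ^+ 2 + 2 * \sum_(j < d) u 0 j * v 0 j.
  rewrite !sqr_enorm mulr_sumr -!big_split/=.
  by apply: eq_bigr => j _; rewrite mxE; ring.
by rewrite lerD2l ler_pM2l ?cauchy_schwarz.
Qed.

Lemma ler_enorm_sum (I : finType) (F : I -> 'rV[R]_d) :
  enorm (\sum_i F i) <= \sum_i enorm (F i).
Proof.
elim/big_ind2 : _ => [|x a y b xa yb|//]; first by rewrite enorm0.
exact: le_trans (ler_enormD _ _) (lerD xa yb).
Qed.

End EuclideanNorm.

(** * Distances between vertices of the control polygon *)

Section ControlPolygon.
Context {R : realType} {d n : nat} (P : 'I_n.+1 -> 'rV[R]_d).

(** [P i - P j] telescopes into [|i - j|] consecutive edges. *)
Lemma enorm_control_sub (i j : 'I_n.+1) :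
  enorm (P i - P j) <=
  `|i%:R - j%:R| * \big[Num.max/0]_(k < n) enorm (Delta P k).
Proof.
set M := \big[_/_]_(_ < _) _.
have step k l : (k + l < n.+1)%N ->
    enorm (P (inord (k + l)) - P (inord k)) <= l%:R * M.
  elim: l => [|l IHl] kl.
    by rewrite addn0 subrr enorm0 mul0r.
  have ltkl : (k + l < n)%N by lia.
  have -> : P (inord (k + l.+1)) - P (inord k) =
      Delta P (Ordinal ltkl) + (P (inord (k + l)) - P (inord k)).
    rewrite /Delta addrA; congr (_ - _); rewrite -addrA.
    have -> : hi (Ordinal ltkl) = inord (k + l.+1).
      by apply/val_inj; rewrite /= inordK// /bump/=; lia.
    have -> : lo (Ordinal ltkl) = inord (k + l).
      by apply/val_inj; rewrite /= inordK//; lia.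
    by rewrite addNr addr0.
  apply: (le_trans (ler_enormD _ _)).
  rewrite -[l.+1]add1n natrD mulrDl mul1r lerD ?IHl//; last lia.
  by rewrite (le_bigmax _ (fun k => enorm (Delta P k))).
wlog ij : i j / (i <= j)%N.
  move=> H; have [|/ltnW] := leqP i j; first exact: H.
  by move=> /H; rewrite -enormN opprB distrC.
rewrite -enormN opprB distrC ger0_norm ?subr_ge0 ?ler_nat//.
rewrite -natrB//.
have := step i (j - i)%N; rewrite subnKC// => /(_ (ltn_ord j)).
by rewrite !inord_val.
Qed.

End ControlPolygon.

(** * Derivatives of Bernstein polynomials and of rational Bézier curves *)

Definition bernstein_deriv (R : realType) (n i : nat) (t : R) : R :=
  'C(n, i)%:R * (i%:R * t ^+ i.-1 * (1 - t) ^+ (n - i)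
                 - (n - i)%:R * t ^+ i * (1 - t) ^+ (n - i).-1).

Section Derivative.
Context {R : realType}.

Lemma is_derive_bernstein (n i : nat) (t : R) :
  is_derive t 1 (bernstein (R := R) n i) (bernstein_deriv R n i t).
Proof.
have dX (m : nat) : is_derive t 1 (fun x : R => x ^+ m) (m%:R * t ^+ m.-1).
  rewrite (_ : (fun x : R => x ^+ m) = id ^+ m); last first.
    by rewrite funeqE => x; rewrite fctE.
  by apply: is_derive_eq; rewrite /= -[RHS]mulr1.
have dY (m : nat) :
    is_derive t 1 (fun x : R => (1 - x) ^+ m) (- (m%:R * (1 - t) ^+ m.-1)).
  rewrite (_ : (fun x : R => (1 - x) ^+ m) = (cst 1 - id) ^+ m); last first.
    by rewrite funeqE => x; rewrite fctE.
  by apply: is_derive_eq; rewrite /= !fctE sub0r scalerN -[in RHS](mulr1 (_ * _)).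
rewrite /bernstein (_ : (fun t : R => _) =
   cst 'C(n, i)%:R * (fun x => x ^+ i) * (fun x => (1 - x) ^+ (n - i))); last first.
  by rewrite funeqE => x; rewrite fctE.
apply: is_derive_eq; rewrite /= /bernstein_deriv !fctE /GRing.scale/=; ring.
Qed.

(** The factor [t (1 - t)] restores the exponents lowered by differentiation, so the derivative
    becomes a multiple of the basis function itself. *)
Lemma bernstein_derivE (n i : nat) (t : R) : (i <= n)%N ->
  t * (1 - t) * bernstein_deriv R n i t =
  (i%:R - n%:R * t) * bernstein n i t.
Proof.
move=> ilen; rewrite /bernstein_deriv /bernstein.
have -> : n%:R = i%:R + (n - i)%:R :> R by rewrite -natrD subnKC.
(* At [m = 0] the predecessor is truncated, but the factor [m] vanishes. *)
have eX (m : nat) (x : R) : m%:R * x ^+ m.-1 * x = m%:R * x ^+ m.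
  by case: m => [|m]; rewrite ?mul0r//= exprSr mulrA.
transitivity ('C(n, i)%:R * ((i%:R * t ^+ i.-1 * t) * ((1 - t) * (1 - t) ^+ (n - i))
  - ((n - i)%:R * (1 - t) ^+ (n - i).-1 * (1 - t)) * (t * t ^+ i))).
  ring.
by rewrite !eX; ring.
Qed.

(** Quotient rule, entry by entry. The numerator is kept as a double sum with coefficients
    antisymmetric in i and j, ready for symmetrization. *)
Lemma is_derive_rational_bezier {d n : nat} (P : 'I_n.+1 -> 'rV[R]_d)
    (w : 'I_n.+1 -> R) (t : R) :
  let a i := w i * bernstein n i t in
  let a' i := w i * bernstein_deriv R n i t in
  \sum_i a i != 0 ->
  derivable (rational_bezier P w) t 1 /\
  'D_1 (rational_bezier P w) t =
    (\sum_i a i) ^- 2 *: \sum_i \sum_j (a' i * a j - a i * a' j) *: P i.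
Proof.
move=> a a' W0.
have dsum (c : 'I_n.+1 -> R) :
    is_derive t 1 (fun x => \sum_i c i * (w i * bernstein n i x))
      (\sum_i c i * a' i).
  rewrite (_ : (fun x => _) =
      \sum_i (c i * w i) \*: (bernstein (R := R) n i)); last first.
    rewrite funeqE => x; rewrite fct_sumE.
    by apply: eq_bigr => i _; rewrite mulrA.
  have -> : \sum_i c i * a' i = \sum_i (c i * w i) *: bernstein_deriv R n i t.
    by apply: eq_bigr => i _; rewrite /a' mulrA.
  by apply: is_derive_sum => i; apply: is_deriveZ; exact: is_derive_bernstein.
have dW : is_derive t 1 (fun x => \sum_i w i * bernstein n i x) (\sum_i a' i).
  rewrite (_ : (fun x => _) = fun x => \sum_i 1 * (w i * bernstein n i x)).
    by under eq_bigr do rewrite -[a' _]mul1r; exact: dsum.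
  by rewrite funeqE => x; apply: eq_bigr => i _; rewrite mul1r.
have dR (k : 'I_1) (j : 'I_d) :
    is_derive t 1 (fun x => rational_bezier P w x k j)
     (((\sum_i a i) ^- 2 *: \sum_i \sum_j (a' i * a j - a i * a' j) *: P i) k j).
  rewrite (_ : (fun x => _) = (fun x => (\sum_i w i * bernstein n i x)^-1) *
     (fun x => \sum_i P i k j * (w i * bernstein n i x))); last first.
    rewrite funeqE => x; rewrite /rational_bezier fctE mxE summxE; congr (_ * _).
    by apply: eq_bigr => i _; rewrite mxE mulrC.
  have dV : is_derive t 1 (fun x => (\sum_i w i * bernstein n i x)^-1)
      (- (\sum_i a i) ^- 2 *: \sum_i a' i).
    apply: DeriveDef; first exact: derivableV.
    by rewrite deriveV// derive_val.
  apply: is_derive_eq.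
  rewrite mxE summxE /GRing.scale/=.
  have -> : \sum_i (\sum_j (a' i * a j - a i * a' j) *: P i) k j =
      (\sum_i P i k j * a' i) * (\sum_i a i) -
      (\sum_i P i k j * a i) * (\sum_i a' i).
    rewrite !mulr_suml -sumrB; apply: eq_bigr => i _.
    rewrite summxE !mulr_sumr -sumrB; apply: eq_bigr => l _.
    by rewrite mxE; ring.
  set N := \sum_i P i k j * (w i * _); set W := \sum_i a i.
  rewrite -/a -/W; field.
  by [].
have dm : derivable (rational_bezier P w) t 1.
  by apply/derivable_mxP => k j; apply: (@ex_derive _ _ _ _ _ _ _ (dR k j)).
split => //; rewrite derive_mx//; apply/matrixP => k j.
by rewrite mxE; apply: derive_val.
Qed.

End Derivative.

(** * Polynomials as coefficient sequences, with a sign test by computation *)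

Section DensePolynomials.
Context {R : realDomainType} {T : Type} (zero : T) (add mul : T -> T -> T).
Context (nonneg : T -> bool) (ev : T -> R).

(** The coefficient operations are parameters, so that coefficients can themselves be polynomials in
    a further variable. *)
Fixpoint dadd (p q : seq T) : seq T :=
  match p, q with
  | [::], _ => q
  | _, [::] => p
  | a :: p', b :: q' => add a b :: dadd p' q'
  end.

Fixpoint dmul (p q : seq T) : seq T :=
  if p is a :: p' then dadd (map (mul a) q) (zero :: dmul p' q) else [::].

Fixpoint deval (x : R) (p : seq T) : R :=
  if p is a :: p' then ev a + x * deval x p' else 0.

Hypothesis ev_zero : ev zero = 0.
Hypothesis ev_add : forall a b, ev (add a b) = ev a + ev b.
Hypothesis ev_mul : forall a b, ev (mul a b) = ev a * ev b.
Hypothesis ev_ge0 : forall a, nonneg a -> 0 <= ev a.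

Lemma deval_add x p q : deval x (dadd p q) = deval x p + deval x q.
Proof.
elim: p q => [|a p IHp] [|b q] /=; rewrite ?add0r ?addr0// IHp ev_add; ring.
Qed.

Lemma deval_mul x p q : deval x (dmul p q) = deval x p * deval x q.
Proof.
elim: p => [|a p IHp] /=; first by rewrite mul0r.
rewrite deval_add /= IHp ev_zero add0r mulrDl mulrA; congr (_ + _).
elim: q {IHp} => [|b q IHq] /=; first by rewrite mulr0.
by rewrite IHq ev_mul; ring.
Qed.

Lemma deval_ge0 x p : 0 <= x -> all nonneg p -> 0 <= deval x p.
Proof.
move=> x0; elim: p => //= a p IHp /andP[/ev_ge0 a0 /IHp p0].
by rewrite addr_ge0// mulr_ge0.
Qed.

End DensePolynomials.

Arguments dadd {T} add p q.
Arguments dmul {T} zero add mul p q.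
Arguments deval {R T} ev x p.
Arguments deval_add {R T add ev} ev_add x p q.
Arguments deval_mul {R T zero add mul ev} ev_zero ev_add ev_mul x p q.
Arguments deval_ge0 {R T nonneg ev} ev_ge0 x p.

(** * Valley weights *)

(* Integer polynomials in three variables, as nested coefficient sequences. *)
Notation poly3 := (seq (seq (seq Z))).

Definition add3 : poly3 -> poly3 -> poly3 := dadd (dadd (dadd Z.add)).
Definition mul3 : poly3 -> poly3 -> poly3 :=
  dmul [::] (dadd (dadd Z.add))
    (dmul [::] (dadd Z.add) (dmul Z0 Z.add Z.mul)).
Definition nonneg3 : poly3 -> bool := all (all (all (Z.leb Z0))).
Definition const3 (n : nat) : poly3 := [:: [:: [:: Z.of_nat n]]].
Definition pow3 (p : poly3) (n : nat) : poly3 := iter n (mul3 p) (const3 1).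
Definition opp3 : poly3 -> poly3 := mul3 [:: [:: [:: Zneg 1]]].
(** The outermost sequence is indexed by powers of the first variable, the innermost by powers of
    the third. *)
Definition X3 : poly3 := [:: [::]; [:: [:: Zpos 1]]].
Definition Y3 : poly3 := [:: [:: [::]; [:: Zpos 1]]].
Definition Z3 : poly3 := [:: [:: [:: Z0; Zpos 1]]].

Arguments add3 : simpl never.
Arguments mul3 : simpl never.
Arguments pow3 : simpl never.
Arguments opp3 : simpl never.
Arguments const3 : simpl never.

Section Eval3.
Context {R : realDomainType} (x y z : R).

Definition zval (a : Z) : R := (int_of_Z a)%:~R.
Definition eval3 : poly3 -> R := deval (deval (deval zval z) y) x.

Lemma zvalD a b : zval (Z.add a b) = zval a + zval b.
Proof. by rewrite /zval -intrD -rmorphD. Qed.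

Lemma zvalM a b : zval (Z.mul a b) = zval a * zval b.
Proof. by rewrite /zval -intrM -rmorphM. Qed.

Lemma zval0 : zval Z0 = 0.
Proof. by []. Qed.

Lemma zval1 : zval (Zpos 1) = 1.
Proof. by []. Qed.

Lemma zval_ge0 a : Z.leb Z0 a -> 0 <= zval a.
Proof. by case: a => [|a|a] //= _; rewrite /zval/= ler0z. Qed.

Let eval1D := deval_add zvalD z.
Let eval1M := deval_mul zval0 zvalD zvalM z.
Let eval2D := deval_add eval1D y.
Let eval2M := deval_mul (erefl : deval zval z [::] = 0) eval1D eval1M y.

Lemma eval3D p q : eval3 (add3 p q) = eval3 p + eval3 q.
Proof. exact: deval_add eval2D x p q. Qed.

Lemma eval3M p q : eval3 (mul3 p q) = eval3 p * eval3 q.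
Proof.
exact: deval_mul (erefl : deval (deval zval z) y [::] = 0) eval2D eval2M x p q.
Qed.

Lemma eval3C n : eval3 (const3 n) = n%:R.
Proof.
rewrite /eval3/= !mulr0 !addr0 /zval (_ : int_of_Z _ = n%:Z)//; lia.
Qed.

Lemma eval3N p : eval3 (opp3 p) = - eval3 p.
Proof. rewrite eval3M /eval3/= /zval/=; ring. Qed.

Lemma eval3X p n : eval3 (pow3 p n) = eval3 p ^+ n.
Proof. by elim: n => [|n IHn]; rewrite ?eval3C// [LHS]eval3M IHn exprS. Qed.

Lemma eval3_X : eval3 X3 = x.
Proof. rewrite /eval3/= ?zval0 zval1; ring. Qed.

Lemma eval3_Y : eval3 Y3 = y.
Proof. rewrite /eval3/= ?zval0 zval1; ring. Qed.

Lemma eval3_Z : eval3 Z3 = z.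
Proof. rewrite /eval3/= ?zval0 zval1; ring. Qed.

Lemma eval3_ge0 p : 0 <= x -> 0 <= y -> 0 <= z -> nonneg3 p -> 0 <= eval3 p.
Proof.
move=> x0 y0 z0.
by do 3![apply: deval_ge0 => // ?]; exact: zval_ge0.
Qed.

Lemma ler_eval3 p q : 0 <= x -> 0 <= y -> 0 <= z ->
  nonneg3 (add3 p (opp3 q)) -> eval3 q <= eval3 p.
Proof.
move=> x0 y0 z0 /(eval3_ge0 _ x0 y0 z0).
by rewrite eval3D eval3N subr_ge0.
Qed.

End Eval3.

(** The distance [|i - j|]: at least one of the truncated differences is 0. *)
Definition ndist (i j : nat) : nat := (i - j + (j - i))%N.

(* The centre is m = gap_num / gap_den at u = t, v = 1 - t, W = Omega, and [gap k]
   is gap_den ^ 2 times the sum for the valley at k.  The factor (u + v)^2 = 1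
   makes it homogeneous in u and v. *)
Definition gap_den {R : comRingType} (u v W : R) : R :=
  u ^+ 2 + 2 * W * u * v + v ^+ 2.
Definition gap_num {R : comRingType} (u v W : R) : R :=
  6 * (u ^+ 2 + W * u * v).

Definition gap_term {R : comRingType} (k : nat) (u v W : R) (i : nat) : R :=
  W ^+ ndist i k * ('C(6, i)%:R * u ^+ i * v ^+ (6 - i)) *
    (6 * W * u * v * gap_den u v W ^+ 2 -
     (u + v) ^+ 2 * (i%:R * gap_den u v W - gap_num u v W) ^+ 2).

Definition gap {R : comRingType} (k : nat) (u v W : R) : R :=
  \sum_(i < 7) gap_term k u v W i.

Local Infix "**" := mul3 (at level 40, left associativity).

(** Reflection of [gap] into coefficient sequences; U, V, W are polynomials, so a substitution is
    expanded before signs are inspected. *)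
Definition gap3 (k : nat) (U V W : poly3) : poly3 :=
  let D := add3 (pow3 U 2) (add3 (const3 2 ** W ** U ** V) (pow3 V 2)) in
  let N := mul3 (const3 6) (add3 (pow3 U 2) (W ** U ** V)) in
  let Q := (const3 6 ** W ** U ** V ** pow3 D 2) in
  let S := pow3 (add3 U V) 2 in
  foldr add3 [::] [seq mul3
      (pow3 W (ndist i k) ** const3 'C(6, i) ** pow3 U i ** pow3 V (6 - i))
      (add3 Q (opp3 (mul3 S
         (pow3 (add3 (mul3 (const3 i) D) (opp3 N)) 2))))
    | i <- iota 0 7].

Lemma eval_gap3 {R : realDomainType} (x y z : R) k U V W :
  eval3 x y z (gap3 k U V W) =
  gap k (eval3 x y z U) (eval3 x y z V) (eval3 x y z W).
Proof.
rewrite /gap -(big_mkord xpredT (gap_term k _ _ _)).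
rewrite /index_iota subn0 /gap3; elim: (iota 0 7) => [|i s IHs].
  by rewrite big_nil /eval3/=.
rewrite big_cons -IHs.
rewrite [LHS]eval3D; congr (_ + _).
rewrite /gap_term /gap_den /gap_num .
rewrite !(eval3N, eval3D, eval3M, eval3X, eval3C); ring.
Qed.

(* After substituting u = W v + y and W = 1 + z, the valley k = 4 has the negative
   monomial -2640 y^4 z and the valley k = 5 has -252 y^7 z (times powers of v);
   for u and v exchanged these are the valleys 2 and 1. *)
Definition corr3 : poly3 :=
  add3
   (const3 1320 ** Z3 ** pow3 Y3 2 ** pow3 X3 6 **
      pow3 (add3 (pow3 X3 2) (opp3 (pow3 Y3 2))) 2)
   (const3 126 ** Z3 ** pow3 Y3 6 ** pow3 X3 4 ** pow3 (add3 X3 (opp3 Y3)) 2).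

(** Region where the larger of u and v is at least W times the smaller one, which is [X3]. One
    correction serves all valleys and both orders: the cross terms of its squares absorb the
    negative monomials. *)
Lemma gap3_far_nonneg :
  let W := add3 (const3 1) Z3 in
  let U := add3 (mul3 W X3) Y3 in
  all (fun k => nonneg3 (add3 (gap3 k U X3 W) (opp3 corr3)) &&
                nonneg3 (add3 (gap3 k X3 U W) (opp3 corr3))) (iota 0 7).
Proof. by vm_compute. Qed.

(** Region where the ratio of the larger to the smaller of u and v, here [1 + Y3], lies between 1
    and W. *)
Lemma gap3_near_nonneg :
  let U := mul3 X3 (add3 (const3 1) Y3) in
  let W := add3 (add3 (const3 1) Y3) Z3 in
  all (fun k => nonneg3 (gap3 k U X3 W) && nonneg3 (gap3 k X3 U W)) (iota 0 7).
Proof. by vm_compute. Qed.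

Lemma gap_ge0 {R : realFieldType} (k : nat) (u v W : R) :
  (k < 7)%N -> 0 <= u -> 0 <= v -> 1 <= W ->
  0 <= gap k u v W.
Proof.
move=> k7 u0 v0 W1.
have kin : k \in iota 0 7 by rewrite mem_iota.
(* Both orders of u and v are treated together, with [a] the smaller and [b] the larger. *)
suff H (a b : R) : 0 <= a -> a <= b -> 0 <= gap k b a W /\ 0 <= gap k a b W.
  have [uv|/ltW vu] := leP u v; first by case: (H u v u0 uv).
  by case: (H v u v0 vu).
move=> a0 ab.
have [b0|bW] := leP (W * a) b.
  set y := b - W * a; set z := W - 1.
  have y0 : 0 <= y by rewrite subr_ge0.
  have z0 : 0 <= z by rewrite subr_ge0.
  have corr0 : 0 <= eval3 a y z corr3.
    rewrite /corr3 !(eval3N, eval3D, eval3M, eval3X, eval3_X,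
       eval3_Y, eval3_Z, eval3C).
    by apply: addr_ge0; apply: mulr_ge0 (sqr_ge0 _);
       apply: mulr_ge0 (exprn_ge0 _ a0); apply: mulr_ge0 (exprn_ge0 _ y0);
       exact: mulr_ge0 (ler0n _ _) z0.
  have eW : eval3 a y z (add3 (const3 1) Z3) = W.
    by rewrite eval3D eval3C eval3_Z addrC subrK.
  have eU : eval3 a y z (add3 (mul3 (add3 (const3 1) Z3) X3) Y3) = b.
    by rewrite eval3D eval3M eW eval3_X eval3_Y addrC subrK.
  have /andP[] := allP gap3_far_nonneg _ kin.
  move=> /(ler_eval3 _ _ _ _ _ a0 y0 z0) Hu /(ler_eval3 _ _ _ _ _ a0 y0 z0) Hv.
  rewrite !eval_gap3 eU eW eval3_X in Hu Hv.
  by split; [exact: le_trans Hu | exact: le_trans Hv].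
(* The near region is parametrized by [b / a]; here [a = 0] would force [b < 0]. *)
have a_gt0 : 0 < a.
  rewrite lt0r a0 andbT; apply/eqP => az; move: bW.
  by rewrite az mulr0 ltNge -{1}az ab.
set y := b / a - 1; set z := W - b / a.
have y0 : 0 <= y by rewrite subr_ge0 ler_pdivlMr// mul1r.
have z0 : 0 <= z by rewrite subr_ge0 ler_pdivrMr// ltW.
have eW : eval3 a y z (add3 (add3 (const3 1) Y3) Z3) = W.
  by rewrite !eval3D eval3C eval3_Z eval3_Y /y /z; ring.
have eU : eval3 a y z (mul3 X3 (add3 (const3 1) Y3)) = b.
  rewrite eval3M eval3D eval3C eval3_Y eval3_X /y; field.
  by rewrite gt_eqF.
have /andP[] := allP gap3_near_nonneg _ kin.
move=> /(eval3_ge0 _ _ _ _ a0 y0 z0) + /(eval3_ge0 _ _ _ _ a0 y0 z0).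
by rewrite !eval_gap3 eU eW eval3_X.
Qed.

(** * Weights with bounded consecutive ratios *)

Section Cone.
Context {R : realFieldType} (n : nat) (W : R) (w g : nat -> R).
Hypothesis W1 : 1 <= W.
Hypothesis w_gt0 : forall i, (i <= n)%N -> 0 < w i.
Hypothesis w_step : forall i, (i < n)%N -> w i.+1 <= W * w i /\ w i <= W * w i.+1.

Let W0 : 0 < W. Proof. exact: lt_le_trans W1. Qed.

Lemma cone_growth i j : (i <= n)%N -> (j <= n)%N -> w i <= W ^+ ndist i j * w j.
Proof.
have H k l : (k + l <= n)%N ->
    w (k + l)%N <= W ^+ l * w k /\ w k <= W ^+ l * w (k + l)%N.
  elim: l => [|l IHl] kl; first by rewrite addn0 expr0 !mul1r.
  rewrite addnS; have [|Hl Hr] := IHl; first lia.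
  have [|Sl Sr] := w_step (k + l)%N; first lia.
  rewrite exprSr; split.
    by apply: (le_trans Sl); rewrite mulrAC [_ * W]mulrC ler_pM2l.
  by apply: (le_trans Hr); rewrite -mulrA ler_pM2l ?exprn_gt0.
move=> iN jN; have [ij|/ltnW ji] := leqP i j.
  have [|_] := H i (j - i)%N; first by rewrite subnKC.
  by rewrite subnKC// /ndist (eqP ij).
have [|+ _] := H j (i - j)%N; first by rewrite subnKC.
by rewrite subnKC// /ndist (eqP ji) addn0.
Qed.

Hypothesis valley :
  forall k, (k <= n)%N -> 0 <= \sum_(i < n.+1) W ^+ ndist i k * g i.

(* The sum is a A + b B, and the valleys at k and k + 1 say that A + W B >= 0 and
   W A + B >= 0. *)
Lemma cone_pair (k : nat) (a b : R) : (k < n)%N -> 0 < a -> 0 < b ->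
  a <= W * b -> b <= W * a ->
  0 <= \sum_(i < n.+1)
    (if (i <= k)%N then a * W ^+ (k - i) else b * W ^+ (i - k.+1)) * g i.
Proof.
move=> kn a0 b0 ab ba.
pose A := \sum_(i < n.+1 | (i <= k)%N) W ^+ (k - i) * g i.
pose B := \sum_(i < n.+1 | ~~ (i <= k)%N) W ^+ (i - k.+1) * g i.
rewrite [leRHS](_ : _ = a * A + b * B); last first.
  rewrite (bigID (fun i : 'I__ => (i <= k)%N))/= !mulr_sumr.
  congr (_ + _); apply: eq_bigr => i ik.
    by rewrite ik mulrA.
  by rewrite (negbTE ik) mulrA.
have Vk : 0 <= A + W * B.
  suff <- : \sum_(i < n.+1) W ^+ ndist i k * g i = A + W * B.
    by apply: valley; exact: ltnW.
  rewrite (bigID (fun i : 'I__ => (i <= k)%N))/= !mulr_sumr.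
  congr (_ + _); apply: eq_bigr => i ik.
    by rewrite /ndist (eqP ik).
  by rewrite mulrA -exprS; congr (W ^+ _ * _); rewrite /ndist; lia.
have Vk1 : 0 <= W * A + B.
  suff <- : \sum_(i < n.+1) W ^+ ndist i k.+1 * g i = W * A + B.
    exact: valley.
  rewrite (bigID (fun i : 'I__ => (i <= k)%N))/= !mulr_sumr.
  congr (_ + _); apply: eq_bigr => i ik.
    by rewrite mulrA -exprS; congr (W ^+ _ * _); rewrite /ndist; lia.
  by congr (W ^+ _ * _); rewrite /ndist; lia.
(* If [A >= 0], then [b <= W a] bounds W times the sum below by b times the valley at k. Otherwise
   [B >= 0], and [a <= W b] does the same with a and the valley at k + 1. *)
have [A0|A0] := leP 0 A.
  have : b * (A + W * B) <= W * (a * A + b * B).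
    rewrite mulrDr mulrDr [W * (b * B)]mulrCA lerD2r mulrA.
    by rewrite ler_wpM2r.
  by move/(le_trans (mulr_ge0 (ltW b0) Vk)); rewrite pmulr_rge0.
have B0 : 0 <= B by move: Vk1; rewrite -(pmulr_rge0 _ W0); nra.
have : a * (W * A + B) <= W * (a * A + b * B).
  rewrite mulrDr mulrDr mulrCA lerD2l mulrA.
  by rewrite ler_wpM2r.
by move/(le_trans (mulr_ge0 (ltW a0) Vk1)); rewrite pmulr_rge0.
Qed.

(* Replace the weights by the ones of [cone_pair] that agree with them at p and q,
   choosing k so that a / b lies in [1/W, W]; the replacement is larger outside
   [p, q] and smaller inside, so it decreases the sum. *)
Lemma cone_ge0 (p q : nat) : (p <= q <= n)%N ->
  (forall i, (i < p)%N || (q < i <= n)%N -> g i <= 0) ->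
  (forall i, (p < i < q)%N -> 0 <= g i) ->
  0 <= \sum_(i < n.+1) w i * g i.
Proof.
move=> /andP[pq qn] g_out g_in.
have pn : (p <= n)%N by exact: leq_trans qn.
(* With a single anchor, the valley at p scaled by [w p] already lies above the weights wherever g
   may be negative by [g_out]. *)
have [epq|ltpq] := eqVneq p q.
  apply: (@le_trans _ _ (\sum_(i < n.+1) w p * (W ^+ ndist i p * g i))).
    by rewrite -mulr_sumr mulr_ge0 ?valley// ltW// w_gt0.
  apply: ler_sum => i _; rewrite mulrA [w p * _]mulrC.
  have iN : (i <= n)%N by rewrite -ltnS.
  have [->|ip] := eqVneq (i : nat) p.
    by rewrite /ndist subnn expr0 mul1r.
  by rewrite ler_wnM2r ?cone_growth// g_out; lia.
have {}ltpq : (p < q)%N by lia.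
(* The values at k and k + 1 for which the weights of [cone_pair] pass through [w p] at p and [w q]
   at q. *)
pose a k := w p / W ^+ (k - p); pose b k := w q / W ^+ (q - k.+1).
have a_gt0 k : 0 < a k by rewrite divr_gt0 ?exprn_gt0 ?w_gt0.
have b_gt0 k : 0 < b k by rewrite divr_gt0 ?exprn_gt0 ?w_gt0.
have [k /andP[pk kq] /andP[ab ba]] :
    exists2 k, (p <= k < q)%N & (a k <= W * b k) && (b k <= W * a k).
  (* A discrete intermediate value argument: take the largest k satisfying C. Failure at k + 1 reads
     [a k < W * b k], since [a] shrinks and [b] grows by the factor W; if k + 1 = q, [cone_growth]
     gives the bound. *)
  pose C k := (p <= k < q)%N && (b k <= W * a k).
  have C0 : exists k, C k.
    exists p; rewrite /C leqnn ltpq /a subnn expr0 divr1 /b ler_pdivrMr ?exprn_gt0//.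
    have := cone_growth q p qn pn.
    rewrite mulrAC -exprS; congr (_ <= W ^+ _ * _); rewrite /ndist; lia.
  have Cq k : C k -> (k <= q)%N by rewrite /C; lia.
  case: (ex_maxnP C0 Cq) => k /andP[pkq ba] kmax; exists k => //.
  rewrite ba andbT; have /andP[pk kq] := pkq.
  have [kq1|kq1] := eqVneq k.+1 q.
    rewrite /b kq1 subnn expr0 divr1 /a ler_pdivrMr ?exprn_gt0//.
    have := cone_growth p q pn qn.
    rewrite mulrAC -exprS; congr (_ <= W ^+ _ * _); rewrite /ndist; lia.
  have : ~~ C k.+1 by apply/negP => /kmax; rewrite ltnn.
  rewrite /C negb_and -ltNge (_ : (_ <= _ < _)%N); last lia.
  have -> : b k.+1 = W * b k.
    rewrite /b (_ : (q - k.+1)%N = (q - k.+2).+1); last lia.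
    by rewrite exprS; field; rewrite expf_neq0 ?gt_eqF.
  have -> : W * a k.+1 = a k.
    rewrite /a (_ : (k.+1 - p)%N = (k - p).+1); last lia.
    by rewrite exprS; field; rewrite expf_neq0 ?gt_eqF.
  by move/ltW.
apply: (le_trans (cone_pair k (a k) (b k) _ (a_gt0 k) (b_gt0 k) ab ba)); first lia.
apply: ler_sum => i _; have iN : (i <= n)%N by rewrite -ltnS.
have [ik|ki] := leqP i k.
  (* Clearing the denominator of [a k] reduces each comparison with [w i] to [cone_growth]. *)
  have aE : a k * W ^+ (k - i) * W ^+ (k - p) = w p * W ^+ (k - i).
    by rewrite /a; field; rewrite expf_neq0 ?gt_eqF.
  have [ip|pi] := ltnP i p.
    rewrite ler_wnM2r ?g_out ?ip//.
    have := cone_growth i p iN pn; congr (_ <= _).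
    apply: (mulIf (x := W ^+ (k - p))); first by rewrite expf_neq0 ?gt_eqF.
    rewrite aE mulrAC -exprD mulrC; congr (_ * W ^+ _); rewrite /ndist; lia.
  have [->|ip] := eqVneq (i : nat) p.
    rewrite (_ : a k * _ = w p)// /a -[RHS]mulr1.
    by field; rewrite expf_neq0 ?gt_eqF.
  rewrite ler_wpM2r ?g_in//; first lia.
  have := cone_growth p i pn iN.
  rewrite -(ler_pM2r (x := W ^+ (k - p))) ?exprn_gt0// aE.
  rewrite -[w p <= _](ler_pM2r (x := W ^+ (k - i))) ?exprn_gt0//.
  rewrite mulrAC -exprD [w i * _]mulrC; congr (_ <= W ^+ _ * _); rewrite /ndist; lia.
have bE : b k * W ^+ (i - k.+1) * W ^+ (q - k.+1) = w q * W ^+ (i - k.+1).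
  by rewrite /b; field; rewrite expf_neq0 ?gt_eqF.
have [qi|iq] := ltnP q i.
  rewrite ler_wnM2r ?g_out ?qi ?iN ?orbT//.
  have := cone_growth i q iN qn; congr (_ <= _).
  apply: (mulIf (x := W ^+ (q - k.+1))); first by rewrite expf_neq0 ?gt_eqF.
  rewrite bE mulrAC -exprD mulrC; congr (_ * W ^+ _); rewrite /ndist; lia.
have [->|ip] := eqVneq (i : nat) q.
  rewrite (_ : b k * _ = w q)// /b -[RHS]mulr1.
  by field; rewrite expf_neq0 ?gt_eqF.
rewrite ler_wpM2r ?g_in//; first lia.
have := cone_growth q i qn iN.
rewrite -(ler_pM2r (x := W ^+ (q - k.+1))) ?exprn_gt0// bE.
rewrite -[w q <= _](ler_pM2r (x := W ^+ (i - k.+1))) ?exprn_gt0//.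
rewrite mulrAC -exprD [w i * _]mulrC; congr (_ <= W ^+ _ * _); rewrite /ndist; lia.
Qed.

End Cone.

(** * The derivative bound *)

(** By convexity the indices with [(i - m)^2 <= c] form an interval, with end points p and q. This
    yields the sign pattern -, +, - of the coefficients. *)
Lemma parabola_range {R : realFieldType} (n : nat) (m c : R) :
  exists p q, [/\ (p <= q <= n)%N,
    forall i, (i < p)%N || (q < i <= n)%N -> c <= (i%:R - m) ^+ 2
  & forall i, (p < i < q)%N -> (i%:R - m) ^+ 2 <= c].
Proof.
pose C i := (i <= n)%N && ((i%:R - m) ^+ 2 <= c).
have outC i : (i <= n)%N -> ~~ C i -> c <= (i%:R - m) ^+ 2.
  by move=> ilen; rewrite /C ilen -ltNge => /ltW.
have [C0|/existsPn noC] := boolP [exists i : 'I_n.+1, C i]; last first.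
  (* No index lies in the interval: [p = q = 0] leaves the inner range empty. *)
  exists 0%N, 0%N; split=> // i; last lia.
  case/orP => // /andP[_ ilen]; apply: outC => //.
  exact: (noC (Ordinal (ilen : (i < n.+1)%N))).
have {}C0 : exists i, C i by case/existsP: C0 => i; exists i.
have Cn i : C i -> (i <= n)%N by case/andP.
case: (ex_minnP C0) => p Cp pmin; case: (ex_maxnP C0 Cn) => q Cq qmax.
have qn := Cn _ Cq.
exists p, q; split; first by rewrite pmin// qn.
  move=> i ipq; apply: outC.
    by have := pmin _ Cq; move: ipq; lia.
  by apply/negP => Ci; have := pmin _ Ci; have := qmax _ Ci; move: ipq; lia.
move=> i /andP[pi iq]; move: Cp Cq; rewrite /C => /andP[_ +] /andP[_ +].
have : p%:R <= i%:R :> R by rewrite ler_nat ltnW.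
have : i%:R <= q%:R :> R by rewrite ler_nat ltnW.
have [im|mi] := leP m i%:R; nra.
Qed.

Lemma variance_bound {R : realType} (W t : R) (w : nat -> R) :
  1 <= W -> (forall i, (i <= 6)%N -> 0 < w i) ->
  (forall i, (i < 6)%N -> w i.+1 <= W * w i /\ w i <= W * w i.+1) ->
  0 <= t <= 1 ->
  exists m, \sum_(i < 7) w i * bernstein 6 i t * (i%:R - m) ^+ 2 <=
    6 * W * t * (1 - t) * \sum_(i < 7) w i * bernstein 6 i t.
Proof.
move=> W1 w0 ws /andP[t0 t1]; have v0 : 0 <= 1 - t by rewrite subr_ge0.
set D := gap_den t (1 - t) W.
have D0 : 0 < D.
  rewrite /D /gap_den; have : 0 <= W * t * (1 - t).
    by rewrite !mulr_ge0// (le_trans _ W1).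
  nra.
pose m := gap_num t (1 - t) W / D; exists m.
pose c := 6 * W * t * (1 - t).
rewrite -subr_ge0 mulr_sumr -sumrB.
pose g i := bernstein 6 i t * (c - (i%:R - m) ^+ 2).
rewrite [leRHS](_ : _ = \sum_(i < 7) w i * g i); last first.
  by apply: eq_bigr => i _; rewrite /g -/c; ring.
have b0 i : 0 <= bernstein 6 i t.
  by rewrite /bernstein !mulr_ge0 ?exprn_ge0.
have [p [q [pq g_out g_in]]] := parabola_range 6 m c.
apply: (@cone_ge0 _ 6 W w g W1 w0 ws _ p q pq).
(* Multiplying the valley sum by [D ^+ 2] clears the denominators of m and gives [gap k]. *)
- move=> k k6; rewrite -(pmulr_rge0 _ (exprn_gt0 2 D0)).
  have := gap_ge0 k t (1 - t) W k6 t0 v0 W1.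
  congr (_ <= _); rewrite mulr_sumr; apply: eq_bigr => i _.
  rewrite /gap_term /g /bernstein /m -/D (_ : t + (1 - t) = 1); last ring.
  by rewrite /c; field; rewrite gt_eqF.
- move=> i /g_out; rewrite -subr_le0 => ?; exact: mulr_ge0_le0.
- move=> i /g_in; rewrite -subr_ge0 => ?; exact: mulr_ge0.
Qed.

(** The variance as a sum over pairs, expanded about an arbitrary centre m; over an ordered ring,
    dropping the last square leaves the second moment about m as an upper bound. *)
Lemma sum_pair_sqr {R : comRingType} (n : nat) (a : 'I_n -> R) (x : 'I_n -> R) (m : R) :
  \sum_i \sum_j a i * a j * (x i - x j) ^+ 2 =
  2 * ((\sum_i a i) * (\sum_i a i * (x i - m) ^+ 2)) -
  2 * (\sum_i a i * (x i - m)) ^+ 2.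
Proof.
set S := \sum_i a i; set T := \sum_i a i * (x i - m); set Q := \sum_i _ * _ ^+ 2.
transitivity (\sum_i (a i * (x i - m) ^+ 2 * S - 2 * (a i * (x i - m)) * T + a i * Q)).
  apply: eq_bigr => i _; rewrite !mulr_sumr -sumrB -big_split/=.
  by apply: eq_bigr => j _; ring.
by rewrite big_split sumrB/= -!mulr_suml -!mulr_sumr -/S -/T -/Q; ring.
Qed.

Section Bound.
Context {R : realType} {d n : nat} (P : 'I_n.+1 -> 'rV[R]_d) (w : 'I_n.+1 -> R).
Hypothesis w_gt0 : forall i, 0 < w i.

Let M := \big[Num.max/0]_(i < n) enorm (Delta P i).

Lemma Omega_ratio (i : 'I_n) :
  w (hi i) <= Omega w * w (lo i) /\ w (lo i) <= Omega w * w (hi i).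
Proof.
have := le_bigmax 0 (fun i => Num.max (w (hi i) / w (lo i)) (w (lo i) / w (hi i))) i.
by rewrite -/(Omega w) ge_max !ler_pdivrMr// => /andP[].
Qed.

Lemma Omega_ge1 : (0 < n)%N -> 1 <= Omega w.
Proof.
move=> n0; have [hl lh] := Omega_ratio (Ordinal n0).
have [le|/ltW le] := leP (w (lo (Ordinal n0))) (w (hi (Ordinal n0))).
  by rewrite -(ler_pM2r (w_gt0 (lo (Ordinal n0)))) mul1r (le_trans le).
by rewrite -(ler_pM2r (w_gt0 (hi (Ordinal n0)))) mul1r (le_trans le).
Qed.

(** Adding the sum with i and j exchanged replaces [P i] by [P i - P j], of norm at most
    [|i - j| M]. What remains is the pair sum of [a i a j (i - j)^2]. *)
Lemma enorm_spread (a : 'I_n.+1 -> R) (m : R) : (forall i, 0 <= a i) ->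
  enorm (\sum_(i < n.+1) \sum_(j < n.+1) ((i%:R - j%:R) * (a i * a j)) *: P i) <=
  M * ((\sum_i a i) * (\sum_(i < n.+1) a i * (i%:R - m) ^+ 2)).
Proof.
move=> a0; set Y := \sum_i _; set T := _ * _.
have eY : 2 *: Y =
    \sum_(i < n.+1) \sum_(j < n.+1) ((i%:R - j%:R) * (a i * a j)) *: (P i - P j).
  rewrite scaler_nat mulr2n {2}/Y exchange_big/= -big_split/=.
  apply: eq_bigr => i _; rewrite -big_split/=; apply: eq_bigr => j _.
  rewrite scalerBr -scaleNr; congr (_ + _ *: _); ring.
rewrite -(ler_pM2l (x := 2))// -[X in X * enorm _]ger0_norm// -enormZ eY.
apply: (le_trans (ler_enorm_sum _ _)).
apply: (@le_trans _ _
    (\sum_(i < n.+1) \sum_(j < n.+1) M * (a i * a j * (i%:R - j%:R) ^+ 2))).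
  apply: ler_sum => i _; apply: (le_trans (ler_enorm_sum _ _)).
  apply: ler_sum => j _; rewrite enormZ normrM [`|a i * _|]ger0_norm ?mulr_ge0//.
  apply: (@le_trans _ _ (`|i%:R - j%:R| * (a i * a j) * (`|i%:R - j%:R| * M))).
    by rewrite ler_wpM2l ?mulr_ge0// enorm_control_sub.
  by rewrite -[(_ - _) ^+ 2]real_normK ?num_real// le_eqVlt;
    apply/orP; left; apply/eqP; ring.
under eq_bigr do rewrite -mulr_sumr.
rewrite -mulr_sumr mulrCA ler_wpM2l//; first exact: bigmax_ge_id.
by rewrite (sum_pair_sqr _ _ (fun i : 'I_n.+1 => i%:R) m) gerBl mulr_ge0// sqr_ge0.
Qed.

End Bound.

(** * The end points of the parameter interval, where [t (1 - t)] vanishes *)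

Lemma bernstein_at0 {R : realType} (n i : nat) :
  bernstein n i (0 : R) = (i == 0%N)%:R.
Proof.
rewrite /bernstein subr0 expr1n mulr1 expr0n.
by case: i => [|i]; rewrite /= ?bin0 ?mulr1 ?mulr0.
Qed.

Lemma bernstein_at1 {R : realType} (n i : nat) : (i <= n)%N ->
  bernstein n i (1 : R) = (i == n)%:R.
Proof.
move=> ilen; rewrite /bernstein subrr expr1n mulr1 expr0n subn_eq0.
by have [->|iNn] := eqVneq i n; rewrite ?leqnn ?binn ?mulr1// leqNgt
  ltn_neqAle iNn ilen mulr0.
Qed.

Lemma bernstein_deriv_at0 {R : realType} (n i : nat) :
  bernstein_deriv R n i 0 = n%:R * ((i == 1%N)%:R - (i == 0%N)%:R).
Proof.
rewrite /bernstein_deriv subr0 !expr1n !mulr1 !expr0n.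
case: i => [|[|i]] /=; rewrite ?bin0 ?bin1 ?subn0; ring.
Qed.

Lemma bernstein_deriv_at1 {R : realType} (n i : nat) : (i <= n)%N ->
  bernstein_deriv R n i 1 = n%:R * ((i == n)%:R - (i.+1 == n)%:R).
Proof.
move=> ilen; rewrite -(subnKC ilen); move: (n - i)%N => l {n ilen}.
rewrite /bernstein_deriv addKn subrr !expr1n !mulr1 !expr0n.
have -> : 'C(i + l, i) = 'C(i + l, l).
  by rewrite -[in LHS](bin_sub (leq_addr l i)) addKn.
case: l => [|[|l]] /=.
- by rewrite bin0 addn0 eqxx (gtn_eqF (ltnSn i)) mulr1n mulr0n; ring.
- by rewrite bin1 addn1 eqxx (ltn_eqF (ltnSn i)) mulr1n mulr0n; ring.
- rewrite (_ : (i == _) = false); last lia.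
  by rewrite (_ : (i.+1 == _) = false) ?mulr0n; [ring | lia].
Qed.

Lemma sum_delta {R : pzRingType} {V : lmodType R} {I : finType} (F : I -> V) (k : I) :
  \sum_i (i == k)%:R *: F i = F k.
Proof.
rewrite (bigD1 k)//= eqxx scale1r big1 ?addr0// => i /negbTE ->.
by rewrite scale0r.
Qed.

Section Endpoint.
Context {R : realType} {d n : nat} (P : 'I_n.+1 -> 'rV[R]_d) (w : 'I_n.+1 -> R).
Hypothesis w_gt0 : forall i, 0 < w i.

(** The vector is [Delta P e] times n times [w (lo e) w (hi e) / (w k)^2]. As k is an end of the
    edge e, this quotient is one of the two ratios of e that enter [Omega]. *)
Lemma endpoint_bound (e : 'I_n) (k : 'I_n.+1) (a a' : 'I_n.+1 -> R) :
  k = lo e \/ k = hi e ->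
  (forall i, a i = w i * (i == k)%:R) ->
  (forall i, a' i = w i * (n%:R * ((i == hi e)%:R - (i == lo e)%:R))) ->
  enorm ((\sum_i a i) ^- 2 *: \sum_i \sum_j (a' i * a j - a i * a' j) *: P i) <=
  derivative_bound P w.
Proof.
move=> ke aE a'E.
have deltaR (F : 'I_n.+1 -> R) l : \sum_i F i * (i == l)%:R = F l.
  by rewrite -[RHS](sum_delta (V := R^o) F); apply: eq_bigr => i _; exact: mulrC.
have aS : \sum_i a i = w k by rewrite -[RHS]deltaR; apply: eq_bigr => i _.
have a'S : \sum_i a' i = n%:R * (w (hi e) - w (lo e)).
  rewrite -[w (hi e)]deltaR -[w (lo e)]deltaR -sumrB mulr_sumr.
  by apply: eq_bigr => i _; rewrite a'E; ring.
have -> : \sum_i \sum_j (a' i * a j - a i * a' j) *: P i =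
    (n%:R * w (lo e) * w (hi e)) *: Delta P e.
  transitivity (\sum_i ((i == hi e)%:R *: ((n%:R * w k * w i) *: P i) -
      (i == lo e)%:R *: ((n%:R * w k * w i) *: P i) -
      (i == k)%:R *: ((n%:R * w i * (w (hi e) - w (lo e))) *: P i))).
    apply: eq_bigr => i _; rewrite -scaler_suml sumrB -!mulr_sumr aS a'S.
    rewrite !scalerA -!scalerBl aE a'E; congr (_ *: _).
    by rewrite /GRing.scale/=; ring.
  rewrite !sumrB !sum_delta /Delta.
  by case: ke => ->; apply/rowP => j; rewrite !mxE; ring.
rewrite aS scalerA enormZ /derivative_bound ler_pM ?enorm_ge0//; last first.
  exact: (le_bigmax _ (fun i => enorm (Delta P i))).
have [hl lh] := Omega_ratio w w_gt0 e.
rewrite ger0_norm; last by rewrite !mulr_ge0 ?invr_ge0 ?sqr_ge0// ltW.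
rewrite mulrC ler_pdivrMr ?exprn_gt0// -!mulrA ler_wpM2l//.
case: ke => ->; last first.
  by rewrite expr2 mulrA ler_wpM2r// ltW.
by rewrite mulrC expr2 mulrA ler_wpM2r// ltW.
Qed.

End Endpoint.

(** * The derivative bound in degree 6 *)

Lemma rational_bezier_derivative_bound {R : realType} (d : nat)
    (P : 'I_7 -> 'rV[R]_d) (w : 'I_7 -> R) (t : R) :
  (forall i, 0 < w i) -> 0 <= t <= 1 ->
  derivable (rational_bezier (n := 6) P w) t 1 /\
  enorm ('D_1 (rational_bezier (n := 6) P w) t) <= derivative_bound (n := 6) P w.
Proof.
move=> w_gt0 t01; have /andP[t0 t1] := t01.
pose a (i : 'I_7) := w i * bernstein 6 i t.
pose a' (i : 'I_7) := w i * bernstein_deriv R 6 i t.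
have v0 : 0 <= 1 - t by rewrite subr_ge0.
have a0 i : 0 <= a i.
  rewrite /a /bernstein; apply: mulr_ge0 (ltW (w_gt0 i)) _.
  by rewrite !mulr_ge0 ?exprn_ge0.
have S0 : 0 < \sum_i a i.
  (* The last basis function is positive for [t > 0], the first one at [t = 0]. *)
  rewrite lt0r sumr_ge0// andbT psumr_neq0//; apply/hasP.
  have [tlt|] := ltP 0 t.
    exists ord_max; rewrite ?mem_index_enum//= mulr_gt0//.
    by rewrite /bernstein subnn expr0 mulr1 binn mul1r exprn_gt0.
  move=> tle; exists ord0; rewrite ?mem_index_enum//= mulr_gt0//.
  rewrite /bernstein bin0 expr0 !mul1r exprn_gt0//; lra.
have [dR ->] := is_derive_rational_bezier P w t (lt0r_neq0 S0).
split=> //; rewrite -/a -/a'.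
have [et|tN0] := eqVneq t 0.
  apply: (endpoint_bound P w w_gt0 ord0 (lo ord0)); first by left.
    by move=> i; rewrite /a et bernstein_at0.
  by move=> i; rewrite /a' et bernstein_deriv_at0.
have [et|tN1] := eqVneq t 1.
  apply: (endpoint_bound P w w_gt0 ord_max (hi ord_max)); first by right.
    by move=> i; rewrite /a et bernstein_at1// -ltnS.
  move=> i; rewrite /a' et bernstein_deriv_at1; last by rewrite -ltnS.
  by congr (_ * (_ * (_%:R - _%:R))).
have c0 : 0 < t * (1 - t) by rewrite mulr_gt0// lt0r ?tN0// subr_eq0 eq_sym tN1.
set X := \sum_i _; set S := \sum_i a i; pose W := Omega w.
have W1 : 1 <= W := Omega_ge1 w w_gt0 isT.
(* The cone lemmas take weights indexed by natural numbers. *)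
pose wn i := w (inord i).
have wn0 i : (i <= 6)%N -> 0 < wn i by move=> _; exact: w_gt0.
have ws i : (i < 6)%N -> wn i.+1 <= W * wn i /\ wn i <= W * wn i.+1.
  move=> i6; have := Omega_ratio w w_gt0 (Ordinal i6).
  rewrite (_ : hi (Ordinal i6) = inord i.+1); last first.
    by apply/val_inj; rewrite /= inordK// /bump/=; lia.
  rewrite (_ : lo (Ordinal i6) = inord i)//.
  by apply/val_inj; rewrite /= inordK//; lia.
have [m] := variance_bound W t wn W1 wn0 ws t01.
under eq_bigr do rewrite /wn inord_val.
under [X in _ <= _ * X]eq_bigr do rewrite /wn inord_val.
rewrite -/S -(ler_pM2l S0) => var.
(* By [bernstein_derivE] the coefficients become [(i - 6 t) - (j - 6 t) = i - j]. *)
have cX : (t * (1 - t)) *: X =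
    \sum_(i < 7) \sum_(j < 7) ((i%:R - j%:R) * (a i * a j)) *: P i.
  rewrite scaler_sumr; apply: eq_bigr => i _.
  rewrite scaler_sumr; apply: eq_bigr => j _; rewrite scalerA; congr (_ *: _).
  have Ei := bernstein_derivE 6 i t (ltn_ord i).
  have Ej := bernstein_derivE 6 j t (ltn_ord j).
  transitivity (w i * a j * (t * (1 - t) * bernstein_deriv R 6 i t) -
     a i * w j * (t * (1 - t) * bernstein_deriv R 6 j t)).
    by rewrite /a' /a; ring.
  by rewrite Ei Ej /a; ring.
set M := \big[Num.max/0]_(i < 6) enorm (Delta P i).
have M0 : 0 <= M by exact: bigmax_ge_id.
have : t * (1 - t) * enorm X <= M * (S * (6 * W * t * (1 - t) * S)).
  rewrite -[t * (1 - t)](ger0_norm (ltW c0)) -enormZ cX.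
  apply: (le_trans (enorm_spread P a m a0)).
  by rewrite ler_wpM2l.
rewrite (_ : M * _ = t * (1 - t) * (6 * W * M * S ^+ 2)); last ring.
rewrite ler_pM2l// enormZ ger0_norm ?invr_ge0 ?sqr_ge0// => H.
by rewrite mulrC ler_pdivrMr ?exprn_gt0.
Qed.

(** * Programs *)

Section Programs.
Context {R : realType} {n d : nat}.
Implicit Types (c : cmd R n d) (s : state R n d) (x : reg n d).

(** Ensures that the run witnessing correctness is the very run described by [exec_free]. *)
Lemma exec_deterministic c s k1 s1 : exec c s k1 s1 ->
  forall k2 s2, exec c s k2 s2 -> k1 = k2 /\ s1 = s2.
Proof.
elim=> {c s k1 s1} [s|x a s|x y s|o x y z s ok|x v s|c1 c2 s s' s'' k k' _ IH1 _ IH2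
  |y z c1 c2 s s' k le _ IH|y z c1 c2 s s' k lt _ IH
  |y z c s s' s'' k k' le _ IH1 _ IH2|y z c s lt] k2 s2 H; inversion H; subst=> //;
  try (by case: (IH _ _ ltac:(eassumption)) => -> ->);
  try (by move: le; rewrite leNgt => /negP[]);
  try (by move: lt; rewrite ltNge => /negP[]);
  have [? ?] := IH1 _ _ ltac:(eassumption); subst;
  by have [-> ->] := IH2 _ _ ltac:(eassumption).
Qed.

(* A run without counted operations takes no branch, so it can only move
   constants and initial values around, in the same way for all inputs. *)
Lemma exec_free c s k s' : exec c s k s' -> k = 0%N ->
  exists f : reg n d -> R + reg n d, forall t, exists2 t', exec c t 0 t' &
    forall x, t' x = match f x with inl a => a | inr y => t y end.
Proof.
elim=> {c s k s'} //.
- by move=> s _; exists inr => t; exists t => //; exact: ExecSkip.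
- move=> x a s _; exists (fun y => if y == x then inl a else inr y) => t.
  exists (update t x a); first exact: ExecConst.
  by move=> y; rewrite /update; case: ifP.
- move=> x y s _; exists (fun z => if z == x then inr y else inr z) => t.
  exists (update t x (t y)); first exact: ExecCopy.
  by move=> z; rewrite /update; case: ifP.
- move=> c1 c2 s s1 s2 k1 k2 _ IH1 _ IH2 /eqP; rewrite addn_eq0.
  case/andP => /eqP k10 /eqP k20; subst.
  have [f1 H1] := IH1 erefl; have [f2 H2] := IH2 erefl.
  exists (fun x => if f2 x is inr y then f1 y else f2 x) => t.
  have [t1 e1 E1] := H1 t; have [t2 e2 E2] := H2 t1.
  exists t2; first exact: ExecSeq e1 e2.
  by move=> x; rewrite E2; case: (f2 x) => [//|y]; rewrite E1.
Qed.

(** By [exec_free], a zero-cost run on one input makes the output, on every input, one fixed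
    constant or the initial content of one fixed register. Two control polygons with unit weights
    rule out each choice. *)
Lemma computes_bound_not_free c : (0 < n)%N -> (0 < d)%N ->
  computes_bound c -> takes_at_least c 1.
Proof.
move=> n0 d0 cc P w w_gt0 k r [s exec_s _]; rewrite lt0n; apply/eqP => k0; subst k.
have [f fE] := exec_free c _ _ _ exec_s erefl.
have boundE Q : derivative_bound (n := n) Q (fun=> 1) =
    match f (scratch n d 0) with
    | inl a => a | inr y => input_state Q (fun=> 1) y end.
  have [k [s1 exec_s1 <-]] := cc Q (fun=> 1) (fun=> ltr01).
  have [t exec_t <-] := fE (input_state Q (fun=> 1)).
  by have [_ ->] := exec_deterministic _ _ _ _ exec_s1 _ _ exec_t.
(* All coordinates are nonpositive while the bound is positive, so no coordinate or scratch register
   holds it. The zero polygon, with bound 0, excludes the weights, and together with Q the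
   constants. *)
pose Q (i : 'I_n.+1) : 'rV[R]_d := const_mx (- i%:R).
have bound0 : derivative_bound (n := n) (fun=> 0 : 'rV[R]_d) (fun=> 1 : R) = 0.
  rewrite /derivative_bound [X in _ * X]big1_idem ?mulr0//=; first exact: maxxx.
  move=> i _.
  by rewrite /Delta subrr enorm0.
have bound_gt0 : 0 < derivative_bound Q (fun=> 1).
  rewrite /derivative_bound !mulr_gt0 ?ltr0n//.
    exact: lt_le_trans ltr01 (Omega_ge1 _ (fun=> ltr01) n0).
  apply: lt_le_trans (le_bigmax _ (fun i => enorm (Delta Q i)) (Ordinal n0)).
  rewrite lt0r enorm_ge0 andbT; apply/eqP => /enorm_eq0 /rowP /(_ (Ordinal d0)).
  by rewrite !mxE /= opprK addr0 => /eqP; rewrite oppr_eq0 oner_eq0.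
move: bound_gt0 (boundE (fun=> 0)); rewrite bound0 (boundE Q).
case: (f _) => [a|[[i|[i j]]|l]] /=.
- by move=> + a0; rewrite -a0 ltxx.
- by move=> _ /esym /eqP; rewrite oner_eq0.
- by rewrite mxE oppr_gt0 ltrn0.
- by rewrite ltxx.
Qed.

(** * A program evaluating the bound, and its operation count *)

Definition max_into (k l : nat) : cmd R n d :=
  IfLe (scratch n d k) (scratch n d l)
    (Copy R (scratch n d k) (scratch n d l)) Skip.

Fixpoint load_delta (i : 'I_n) (r : seq 'I_d) : cmd R n d :=
  if r is j :: r' then
    Seq (load_delta i r')
      (Arith R OpSub (scratch n d (3 + j)) (preg (hi i) j) (preg (lo i) j))
  else Skip.

(** Scratch register 0 holds the running maximum of edge lengths, 1 that of weight ratios, 2 is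
    temporary, and those from 3 on hold the coordinates of the edge. The cost is d subtractions, two
    divisions, three comparisons and one norm. *)
Definition edge_program (i : 'I_n) : cmd R n d :=
  Seq (Arith R OpDiv (scratch n d 2) (wreg d (hi i)) (wreg d (lo i)))
 (Seq (max_into 1 2)
 (Seq (Arith R OpDiv (scratch n d 2) (wreg d (lo i)) (wreg d (hi i)))
 (Seq (max_into 1 2)
 (Seq (load_delta i (index_enum 'I_d))
 (Seq (Norm R (scratch n d 2) (fun j => scratch n d (3 + j)))
      (max_into 0 2)))))).

(** The tail runs first, matching the recursion of the iterated maximum. *)
Fixpoint edges_program (r : seq 'I_n) : cmd R n d :=
  if r is i :: r' then Seq (edges_program r') (edge_program i) else Skip.

Definition bound_program : cmd R n d :=
  Seq (edges_program (index_enum 'I_n))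
 (Seq (Const (scratch n d 2) n%:R)
 (Seq (Arith R OpMul (scratch n d 1) (scratch n d 2) (scratch n d 1))
      (Arith R OpMul (scratch n d 0) (scratch n d 1) (scratch n d 0)))).

Lemma update_scratch s k a l :
  update s (scratch n d k) a (scratch n d l) =
  if l == k then a else s (scratch n d l).
Proof. by []. Qed.

Lemma exec_max_into s k l :
  exec (max_into k l) s 1 (update s (scratch n d k)
    (Num.max (s (scratch n d k)) (s (scratch n d l)))).
Proof.
have [le|lt] := leP (s (scratch n d k)) (s (scratch n d l)).
  by apply: ExecIfTrue => //; exact: ExecCopy.
apply: ExecIfFalse => //.
rewrite (_ : update _ _ _ = s); first exact: ExecSkip.
by rewrite funeqE => x; rewrite /update; case: eqP => [->|].
Qed.

Lemma exec_load_delta i r s : exists s',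
  [/\ exec (load_delta i r) s (size r) s',
      forall j, j \in r -> s' (scratch n d (3 + j)) =
                           s (preg (hi i) j) - s (preg (lo i) j),
      forall y : 'I_n.+1 + 'I_n.+1 * 'I_d, s' (inl y) = s (inl y)
    & forall l, (l < 3)%N -> s' (scratch n d l) = s (scratch n d l)].
Proof.
elim: r => [|j r [s1 [e1 d1 in1 out1]]] /=.
  by exists s; split => //; exact: ExecSkip.
eexists; split.
- by rewrite -[(size r).+1]addn1; apply: ExecSeq e1 _; exact: ExecArith.
- move=> l; rewrite inE update_scratch eqn_add2l -val_eqE /=.
  have [/val_inj -> _|_ /=] := eqVneq; last exact: d1.
  by rewrite /= !in1.
- by move=> x; rewrite -in1.
- move=> l l3; rewrite update_scratch -out1//.
  by rewrite ifF//; apply/negbTE; lia.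
Qed.

Context (P : 'I_n.+1 -> 'rV[R]_d) (w : 'I_n.+1 -> R).
Hypothesis w_gt0 : forall i, 0 < w i.

Lemma exec_edges r : exists s,
  [/\ exec (edges_program r) (input_state P w) (size r * (d + 6)) s,
      forall y : 'I_n.+1 + 'I_n.+1 * 'I_d, s (inl y) = input_state P w (inl y),
      s (scratch n d 1) =
        \big[Num.max/0]_(i <- r) Num.max (w (hi i) / w (lo i)) (w (lo i) / w (hi i))
    & s (scratch n d 0) = \big[Num.max/0]_(i <- r) enorm (Delta P i)].
Proof.
elim: r => [|i r [s [es ins s1 s0]]] /=.
  (* Scratch registers start at 0, the default value of the maxima. *)
  by exists (input_state P w); rewrite !big_nil; split => //; exact: ExecSkip.
(* The explicit state is the one reached after both ratios have entered the maximum in register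
   1. *)
have [t [et tD tin tout]] := exec_load_delta i (index_enum 'I_d)
  (let u := update s (scratch n d 2) (w (hi i) / w (lo i)) in
   let u1 := update u (scratch n d 1)
     (Num.max (u (scratch n d 1)) (u (scratch n d 2))) in
   let u2 := update u1 (scratch n d 2) (w (lo i) / w (hi i)) in
   update u2 (scratch n d 1) (Num.max (u2 (scratch n d 1)) (u2 (scratch n d 2)))).
have tN : enorm (\row_(j < d) t (scratch n d (3 + j))) = enorm (Delta P i).
  congr enorm; apply/rowP => j; rewrite !mxE tD ?mem_index_enum//.
  by rewrite /update/= !ins.
eexists; split.
- rewrite mulSn addnC; apply: ExecSeq es _.
  have -> : (d + 6 = 1 + (1 + (1 + (1 + (size (index_enum 'I_d) + (1 + 1))))))%N.
    by rewrite -[X in (size X + _)%N]enumT size_enum_ord; lia.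
  apply: ExecSeq; first by apply: ExecArith; rewrite /= ins /= gt_eqF.
  apply: ExecSeq; first exact: exec_max_into.
  apply: ExecSeq; first by apply: ExecArith; rewrite /update /= ins /= gt_eqF.
  apply: ExecSeq; first exact: exec_max_into.
  apply: ExecSeq.
    by rewrite /update /= !ins /=; rewrite /update /= in et; exact: et.
  apply: ExecSeq; [exact: ExecNorm | exact: exec_max_into].
- by move=> y; transitivity (s (inl y)); [exact: tin | exact: ins].
- rewrite !update_scratch/= tout//= !update_scratch/= big_cons s1.
  by rewrite [RHS]maxC maxA.
- rewrite !update_scratch/= tN tout//= !update_scratch/= big_cons s0.
  by rewrite [RHS]maxC.
Qed.

Lemma bound_program_evaluates :
  evaluates_to bound_program P w (n * (d + 6) + 2) (derivative_bound P w).
Proof.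
have [s [es _ s1 s0]] := exec_edges (index_enum 'I_n).
have szn : size (index_enum 'I_n) = n by rewrite -[index_enum _]enumT size_enum_ord.
rewrite szn in es.
rewrite (_ : n * (d + 6) + 2 = n * (d + 6) + (0 + (1 + 1)))%N//; eexists.
  apply: ExecSeq es _.
  apply: ExecSeq; first exact: ExecConst.
  by apply: ExecSeq; exact: ExecArith.
by rewrite !update_scratch/= s1 s0.
Qed.

End Programs.

Theorem theorem1 (R : realType) (d : nat) (hd : (1 <= d)%N) :
  (forall (P : 'I_7 -> 'rV[R]_d) (w : 'I_7 -> R),
     (forall i, 0 < w i) ->
     forall t : R, 0 <= t <= 1 ->
       derivable (rational_bezier (n := 6) P w) t 1 /\
       enorm ('D_1 (rational_bezier (n := 6) P w) t) <=
         derivative_bound (n := 6) P w) /\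
  (exists T0 T1 : nat,
     [/\ (0 < T0)%N,
         exists c : cmd R 6 d, computes_bound c /\ runs_within c T1
       & forall c : cmd R 6 d, computes_bound c -> takes_at_least c T0]).
Proof.
split=> [P w w_gt0 t t01|]; first exact: rational_bezier_derivative_bound.
(* Six edges cost d + 6 operations each, followed by two multiplications; both time bounds depend on
   d at most. *)
exists 1%N, (6 * (d + 6) + 2)%N; split=> //.
  exists bound_program; split=> P w w_gt0.
    by exists (6 * (d + 6) + 2)%N; exact: bound_program_evaluates.
  exists (6 * (d + 6) + 2)%N, (derivative_bound P w).
  by split=> //; exact: bound_program_evaluates.
by move=> c; exact: computes_bound_not_free.
Qed.
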